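(* Let $s$ be an even positive integer and let $n$ be an integer with $n>3s$. Let $$f(X)=X^n+X^{n-s}+X^{n-2s}+X^{n-3s}+1\in\mathbb{F}_2[X]\quad\text{and}\quad g(X)=X^n+X^{3s}+X^{2s}+X^s+1\in\mathbb{F}_2[X].$$ If $n\not\equiv \pm 1\pmod 8$, then $f$ and $g$ are reducible over $\mathbb{F}_2$.
   Context: $\mathbb{F}_2$ denotes the field with two elements. A polynomial is reducible if it is a product of two non-constant polynomials in $\mathbb{F}_2[X]$. *)

(* Defs.v *)
From mathcomp Require Import all_boot all_order all_algebra.

Set Implicit Arguments.
Unset Strict Implicit.
Unset Printing Implicit Defensive.

Import GRing.Theory.
Local Open Scope ring_scope.

(* Since size p is the degree plus one (and 0 for p = 0), 1 < size p says that
   p is non-constant. *)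
Definition reducible_poly (R : nzRingType) (p : {poly R}) : Prop :=
  exists q r : {poly R}, [/\ (1 < size q)%N, (1 < size r)%N & p = q * r].

(* The exponents use truncated subtraction, hence are the intended ones only when
   3 * s <= n. *)
Definition pentaf (n s : nat) : {poly 'F_2} :=
  'X^n + 'X^(n - s) + 'X^(n - 2 * s) + 'X^(n - 3 * s) + 1.

Definition pentag (n s : nat) : {poly 'F_2} :=
  'X^n + 'X^(3 * s) + 'X^(2 * s) + 'X^s + 1.

(* Main.v *)
Require Import Defs.
From mathcomp Require Import all_boot all_order all_algebra.
From HB Require Import structures.
From mathcomp Require Import all_field ring zify.

Set Implicit Arguments.
Unset Strict Implicit.
Unset Printing Implicit Defensive.

Import GRing.Theory.
Local Open Scope ring_scope.

(** Write s = 2 t. Over F_2 one has (1 + Y)^6 = (1 + Y^2) (1 + Y^4), so that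
    g = X^n + (1 + X^t)^6, and f = X^n g(1/X) is the reciprocal of g. Hence it suffices to treat g ([reducible_recip]). If n is even, then g is
    the square of X^(n/2) + (1 + X^t)^3. So let n = 3 or 5 modulo 8 and suppose
    that g is irreducible; the contradiction is the classical argument of
    Stickelberger: an irreducible polynomial of odd degree has a cyclic Galois
    group of odd order, which consists of even permutations, so the
    discriminant of any lift of g modulo 8 must be a square in the unramified
    extension of Z/8, although its value turns out to be 5.

    The lift is G = X^n + (1 + X^t)^6 over Z/8. The ring R = (Z/8)[X]/(G) has
    residue field K = F_2[X]/(g) with 2^n elements ([residue_unramified]). The
    n conjugates x^(2^i) of the class x of X are distinct roots of g in K, and
    Hensel's lemma lifts them to roots a_i of G in R ([hensel]); since all the
    differences a_i - a_j are regular, G is the product of the X - a_i.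
    Therefore, with d the product of the a_i - a_j for j < i, the product of
    the G'(a_i) is d^2 up to sign ([prod_diff_square]).

    On the other hand the product of the G'(a_i) is n ([prod_deriv_pentalift]).
    Indeed a_i^n = - (1 + a_i^t)^6 gives
      a_i (1 + a_i^t) G'(a_i)
        = - (1 + a_i^t)^6 (n + (n - 6 t) a_i^t),
    and the product over i of an expression u + v a_i^t is easy to find
    when u and v are so close that (v - u)^6 = 0, which is the case for u = n
    and v = n - 6 t because 6^6 is divisible by 8 ([prod_affine_roots]).

    So d^2 = n or d^2 = - n, that is d^2 = 3 or d^2 = 5 in R. As d reduces to 1
    in K, it has the form 1 + 2 e, and d^2 = 1 + 4 (e^2 + e). The value 3 is not
    of this form, and the value 5 forces e^2 + e + 1 = 0 in K, that is, a
    primitive cube root of unity in a field with 2^n elements, n odd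
    ([no_cube_root]). *)

(** * Products over the roots of X^n + (1 + X^t)^6 *)

(** Over F_2 this is the pentanomial g with s = 2 t. Over Z/8 it is a lift of g
    whose derivative is n X^(n-1) plus a multiple of (1 + X^t)^5, which is what
    makes its discriminant computable. *)
Definition pentalift (R : nzRingType) (n t : nat) : {poly R} :=
  'X^n + (1 + 'X^t) ^+ 6.

Lemma monic_pentalift (S : nzRingType) n t : (6 * t < n)%N ->
  pentalift S n t \is monic /\ size (pentalift S n t) = n.+1.
Proof.
move=> tn.
have sm : (size ((1 + 'X^t) ^+ 6 : {poly S}) < size ('X^n : {poly S}))%N.
  rewrite size_polyXn ltnS; apply: leq_trans (size_poly_exp_leq _ _) _.
  have : (size (1 + 'X^t : {poly S})%R <= t.+1)%N.
    rewrite (leq_trans (size_polyD _ _)) // size_poly1 size_polyXn.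
    by rewrite geq_max ltnS leqnn.
  by lia.
by rewrite monicE lead_coefDl // lead_coefXn size_polyDl // size_polyXn.
Qed.

Lemma horner_pentalift (S : comNzRingType) n t (x : S) :
  (pentalift S n t).[x] = x ^+ n + (1 + x ^+ t) ^+ 6.
Proof.
rewrite /pentalift -polyC1.
by rewrite !(hornerD, horner_exp, hornerXn, hornerX, hornerC).
Qed.

Lemma map_pentalift (S T : nzRingType) (f : {rmorphism S -> T}) n t :
  map_poly f (pentalift S n t) = pentalift T n t.
Proof. by rewrite /pentalift !(rmorphD, rmorphXn, rmorph1) /= !map_polyX. Qed.

(** The factor x (1 + x^t) completes the powers x^(n-1), x^(t-1) and
    (1 + x^t)^5 of the derivative to x^n, x^t and (1 + x^t)^6, so that the
    equation of a root x applies. *)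
Lemma horner_deriv_pentalift (S : comNzRingType) n t (x : S) :
    (0 < t)%N -> (0 < n)%N ->
  x * (1 + x ^+ t) * (pentalift S n t)^`().[x]
  = n%:R * (1 + x ^+ t) * x ^+ n + (6 * t)%:R * x ^+ t * (1 + x ^+ t) ^+ 6.
Proof.
case: t => // t _; case: n => // n _.
rewrite /pentalift -polyC1 derivD derivXn deriv_exp derivD derivC derivXn.
rewrite add0r /=.
rewrite !(hornerD, hornerMn, hornerM, horner_exp, hornerXn, hornerX, hornerC).
rewrite natrM -[x ^+ n *+ _]mulr_natr -[x ^+ t *+ _]mulr_natr !(exprS x).
move: n.+1%:R t.+1%:R (x ^+ n) (x ^+ t) => N T X Y; ring.
Qed.

Lemma char_poly_horner (R : comNzRingType) m (A : 'M[R]_m) a :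
  (char_poly A).[a] = \det (a%:M - A).
Proof.
rewrite -horner_evalE -det_map_mx; congr (\det _); apply/matrixP=> i j.
by rewrite !mxE /= /horner_eval !hornerE hornerMn hornerX.
Qed.

Lemma exists_char_poly (R : comNzRingType) m (p : {poly R}) :
  p \is monic -> size p = m.+1 -> exists A : 'M[R]_m, char_poly A = p.
Proof.
move=> pM sp; have <- : (size p).-1 = m by rewrite sp.
by exists (companionmx p); apply: companionmxK.
Qed.

Lemma det_expmx (R : comNzRingType) m (A : 'M[R]_m.+1) n :
  \det (A ^+ n) = (\det A) ^+ n.
Proof. by elim: n => [|n IH]; rewrite ?expr0 ?det1 // !exprS det_mulmx IH. Qed.

(** Let C be a matrix with characteristic polynomial X^t - k. Both sides are the
    determinant of (-C)^n: as C^t = k and (1 + k)^6 = 0, the lift takes the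
    value C^n at C, while its factors take the values C - a_i, and
    \det (a_i - C) = a_i^t - k. *)
Lemma prod_root_power_sub (R : comNzRingType) n t (a : 'I_n -> R) (k : R) :
    (0 < t)%N -> odd n -> (1 + k) ^+ 6 = 0 ->
    pentalift R n t = \prod_i ('X - (a i)%:P) ->
  \prod_i (a i ^+ t - k) = (- k) ^+ n.
Proof.
case: t => // t _ n_odd k6 fact_g.
have pM : 'X^(t.+1) - k%:P \is monic by rewrite monicXnsubC.
have [C charC] := exists_char_poly pM (size_XnsubC k (ltn0Sn t)).
have Ck : C ^+ t.+1 = k%:M.
  apply/eqP; rewrite -subr_eq0; apply/eqP; rewrite -(Cayley_Hamilton C) charC.
  by rewrite rmorphB rmorphXn /= horner_mx_X horner_mx_C.
have detC : \det (- C) = - k.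
  have := char_poly_horner C 0.
  by rewrite charC !hornerE expr0n /= sub0r raddf0 sub0r.
rewrite -[in RHS]detC -det_expmx.
have -> : (- C) ^+ n = horner_mx C (\prod_i ((a i)%:P - 'X)).
  have -> : \prod_i ((a i)%:P - 'X) = - pentalift R n t.+1.
    under eq_bigr do rewrite -opprB.
    by rewrite prodrN -fact_g card_ord -signr_odd n_odd mulN1r.
  rewrite exprNn -signr_odd n_odd mulN1r rmorphN; congr (- _).
  rewrite /pentalift !(rmorphD, rmorphXn, rmorph1) /= horner_mx_X Ck.
  rewrite -(rmorph1 (@scalar_mx R t.+1)) -rmorphD /= -rmorphXn k6 /=.
  by rewrite rmorph0 addr0.
rewrite rmorph_prod.
rewrite (big_morph determinant (id1 := 1) (op1 := *%R) (@det_mulmx R t.+1));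
  last exact: det1.
apply: eq_bigr => i _.
by rewrite rmorphB /= horner_mx_C horner_mx_X -char_poly_horner charC !hornerE.
Qed.

(** This is the previous lemma for k = - u / v, where the inverse of v is v. *)
Lemma prod_affine_roots (R : comNzRingType) n t (a : 'I_n -> R) (u v : R) :
    (0 < t)%N -> odd n -> v ^+ 2 = 1 -> (v - u) ^+ 6 = 0 ->
    pentalift R n t = \prod_i ('X - (a i)%:P) ->
  \prod_i (u + v * a i ^+ t) = u ^+ n.
Proof.
move=> t_gt0 n_odd v2 uv6 fact_g.
have k6 : (1 + - (u * v)) ^+ 6 = 0.
  have -> : 1 + - (u * v) = v * (v - u).
    by rewrite mulrBr -expr2 v2 [u * v]mulrC.
  by rewrite exprMn uv6 mulr0.
have := prod_root_power_sub t_gt0 n_odd k6 fact_g.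
have vuv : v * (u * v) = u by rewrite mulrCA -expr2 v2 mulr1.
move/(congr1 (fun z => v ^+ n * z)); rewrite opprK -exprMn vuv.
move<-; rewrite -[n in v ^+ n]card_ord -prodr_const -big_split /=.
by apply: eq_big => // i _; rewrite mulrDr addrC vuv.
Qed.

(** * Factorization and discriminant *)

(** Regularity of the differences stands in for the absence of zero divisors, as
    the rings of interest are extensions of Z/8. *)
Lemma prod_XsubC_of_roots (R : comNzRingType) n (p : {poly R}) (a : 'I_n -> R) :
    p \is monic -> size p = n.+1 -> (forall i, p.[a i] = 0) ->
    (forall i j, i != j -> GRing.lreg (a i - a j)) ->
  p = \prod_i ('X - (a i)%:P).
Proof.
elim: n p a => [|n IH] p a pM sp pa0 reg_a.
  rewrite big_ord0; have /size_poly1P[c _ pc] : size p == 1%N by rewrite sp.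
  by move: pM; rewrite pc monicE lead_coefC => /eqP->.
have /factor_theorem[q pq] : root p (a ord0) by rewrite /root pa0.
have qM : q \is monic by move: pM; rewrite pq monicMr ?monicXsubC.
have sq : size q = n.+1.
  move: sp; rewrite pq size_Mmonic ?monicXsubC ?monic_neq0 //.
  by rewrite size_XsubC addn2 => -[].
rewrite pq big_ord_recl mulrC; congr (_ * _).
apply: IH => // [i|i j ij]; last by apply: reg_a; rewrite (inj_eq lift_inj).
apply: (reg_a (lift ord0 i) ord0); first by rewrite eq_sym neq_lift.
by rewrite mulr0 mulrC -[RHS](pa0 (lift ord0 i)) pq hornerM hornerXsubC.
Qed.

Lemma horner_deriv_prod (R : comNzRingType) n (a : 'I_n -> R) i :
  (\prod_j ('X - (a j)%:P))^`().[a i] = \prod_(j | j != i) (a i - a j).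
Proof.
rewrite (bigD1 i) //= derivM derivXsubC mul1r hornerD hornerM hornerXsubC subrr.
rewrite mul0r addr0 horner_prod; apply: eq_bigr => j _; exact: hornerXsubC.
Qed.

Lemma prod_diff_square (R : comNzRingType) n (a : 'I_n -> R) :
  exists (d : R) k, \prod_i \prod_(j | j != i) (a i - a j) = (-1) ^+ k * d ^+ 2.
Proof.
pose d := \prod_(i < n) \prod_(j < n | (j < i)%N) (a i - a j).
exists d, (\sum_(i < n) #|[pred j : 'I_n | (j < i)%N]|)%N.
have -> : \prod_i \prod_(j | j != i) (a i - a j)
  = d * \prod_(i < n) \prod_(j < n | (i < j)%N) (a i - a j).
  rewrite -big_split; apply: eq_bigr => i _ /=.
  rewrite (bigID (fun j : 'I_n => (j < i)%N)) /=; congr (_ * _);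
    apply: eq_bigl => j; rewrite -(inj_eq val_inj) /=; lia.
rewrite expr2 mulrCA; congr (_ * _).
rewrite (exchange_big_dep xpredT) //= expr_sum -big_split /=.
by apply: eq_bigr => i _; rewrite -prodrN; apply: eq_bigr => j _; rewrite opprB.
Qed.

(** Multiply the formula of [horner_deriv_pentalift] over all the roots. The
    product of the 1 + a_i^t is 1 and that of the n + (n - 6 t) a_i^t is
    n^n = n, both by [prod_affine_roots]; the product of the a_i is -1, as n
    is odd and the constant coefficient of the lift is 1. *)
Lemma prod_deriv_pentalift (S : comNzRingType) n t (a : 'I_n -> S) :
    (0 < t)%N -> (6 * t < n)%N -> odd n -> 8 = 0 :> S ->
    pentalift S n t = \prod_i ('X - (a i)%:P) ->
  \prod_i (pentalift S n t)^`().[a i] = n%:R.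
Proof.
move=> t0 tn n_odd c8 fact.
have odd_sq m : odd m -> m%:R ^+ 2 = 1 :> S.
  move=> m_odd; have [q ->] : exists q, m = (2 * q).+1 by exists (m./2); lia.
  have [r rE] : exists r, (q * q.+1 = 2 * r)%N.
    by exists ((q * q.+1)./2); rewrite mul2n halfK oddM /= andbN subn0.
  rewrite -natrX (_ : _ ^ 2 = 8 * r + 1)%N; last by nia.
  by rewrite natrD natrM c8 mul0r add0r.
have root_a i : a i ^+ n = - (1 + a i ^+ t) ^+ 6.
  apply/eqP; rewrite -addr_eq0 -horner_pentalift fact horner_prod (bigD1 i) //=.
  by rewrite hornerXsubC subrr mul0r.
have prod1 : \prod_i (1 + a i ^+ t) = 1.
  rewrite -[RHS](expr1n _ n) -(prod_affine_roots (v := 1) t0 n_odd _ _ fact);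
    rewrite ?expr1n ?subrr ?expr0n //.
  by apply: eq_bigr => i _; rewrite mul1r.
have natb : (n - 6 * t)%:R = n%:R - 6 * t%:R :> S.
  by rewrite -natrM natrB // ltnW.
have prodn : \prod_i (n%:R + (n - 6 * t)%:R * a i ^+ t) = n%:R.
  rewrite (prod_affine_roots t0 n_odd _ _ fact).
  - rewrite -[n in _ ^+ n]odd_double_half n_odd -mul2n exprD exprM.
    by rewrite odd_sq // expr1n mulr1.
  - by apply: odd_sq; lia.
  rewrite natb addrAC subrr sub0r.
  have -> : - (6 * t%:R) = 2 * (- (3 * t%:R)) :> S by ring.
  have -> (u : S) : (2 * u) ^+ 6 = 8 * (8 * u ^+ 6) by ring.
  by rewrite c8 mul0r.
have proda : \prod_i a i = -1.
  have := congr1 (fun p => p.[0]) fact.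
  rewrite horner_pentalift !expr0n (gtn_eqF t0) gtn_eqF; last by lia.
  rewrite add0r addr0 expr1n horner_prod.
  under eq_bigr do rewrite hornerXsubC sub0r.
  rewrite prodrN card_ord -signr_odd n_odd mulN1r.
  by move/(congr1 -%R) ->; rewrite opprK.
have key i : a i * (1 + a i ^+ t) * (pentalift S n t)^`().[a i]
   = - (1 + a i ^+ t) ^+ 6 * (n%:R + (n - 6 * t)%:R * a i ^+ t).
  rewrite horner_deriv_pentalift //; last by lia.
  rewrite root_a natb natrM; ring.
have : \prod_i (a i * (1 + a i ^+ t) * (pentalift S n t)^`().[a i])
   = \prod_i (- (1 + a i ^+ t) ^+ 6 * (n%:R + (n - 6 * t)%:R * a i ^+ t)).
  by apply: eq_bigr.
rewrite !big_split /= proda prod1 prodn prodrN prodrXl prod1 card_ord.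
by rewrite -signr_odd n_odd expr1n !mulr1 !mulN1r => /oppr_inj.
Qed.

(** * Hensel lifting from characteristic 2 to characteristic 8 *)

Lemma horner_taylor_order2 (S : comNzRingType) (p : {poly S}) x h :
  exists c, p.[x + h] = p.[x] + p^`().[x] * h + c * h ^+ 2.
Proof.
elim/poly_ind: p => [|p c [d IH]].
  by exists 0; rewrite deriv0 !horner0 !mul0r !addr0.
exists (p^`().[x] + d * (x + h)).
rewrite derivMXaddC !(hornerMXaddC, hornerD, hornerM, hornerX) IH; ring.
Qed.

(** The properties that the argument uses of the reduction map of an unramified
    extension of Z/8 onto its residue field: the kernel is generated by 2, and R
    is flat over Z/8, in the form that 4 kills nothing but the kernel. *)
Definition unramified_mod8 (R : comNzRingType) (K : fieldType)
    (pi : {rmorphism R -> K}) : Prop :=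
  [/\ forall x, exists a, pi a = x,
      forall a, pi a = 0 -> exists b, a = 2 * b,
      forall a, 4 * a = 0 -> pi a = 0
    & 8 = 0 :> R].

Section Unramified.
Variables (R : comNzRingType) (K : fieldType) (pi : {rmorphism R -> K}).
Hypothesis piU : unramified_mod8 pi.

Lemma residue_two : 2 = 0 :> K.
Proof.
have [_ _ tors c8] := piU; rewrite -[2](rmorph_nat pi 2); apply: tors.
by rewrite -c8; ring.
Qed.

(** If a z = 0 then z reduces to 0, so z = 2 z'; flatness allows dividing the
    relation a z = 0 by 2, and so on until z is a multiple of 8. *)
Lemma lreg_of_residue a : pi a != 0 -> GRing.lreg a.
Proof.
have [_ ker tors c8] := piU => pia b c abc.
apply/eqP; rewrite -subr_eq0; apply/eqP.
have {abc} : a * (b - c) = 0 by rewrite mulrBr abc subrr.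
move: (b - c) => z az.
have ker0 w : pi (a * w) = 0 -> exists w', w = 2 * w'.
  by rewrite rmorphM => /eqP; rewrite mulf_eq0 (negPf pia) => /eqP/ker.
have [z1 zE] : exists z', z = 2 * z' by apply: ker0; rewrite az rmorph0.
have [z2 z1E] : exists z', z1 = 2 * z'.
  apply: ker0; apply: tors.
  have -> : 4 * (a * z1) = 2 * (a * z) by rewrite zE; ring.
  by rewrite az mulr0.
have [z3 z2E] : exists z', z2 = 2 * z'.
  by apply: ker0; apply: tors; rewrite -az zE z1E; ring.
have -> : z = 8 * z3 by rewrite zE z1E z2E; ring.
by rewrite c8 mul0r.
Qed.

(** Let v in R reduce to the inverse of p'(x). The step from a to a - p(a) v,
    with the same v at each time, improves a root modulo 2^k to a root modulo
    2^(k+1), and 2^3 = 0. *)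
Lemma hensel (p : {poly R}) x :
    (map_poly pi p).[x] = 0 -> (map_poly pi p)^`().[x] != 0 ->
  exists2 a, pi a = x & p.[a] = 0.
Proof.
have [surj ker _ c8] := piU => px0 p'x.
suff /(_ 2%N)[a ax [c pa]] k :
    exists2 a, pi a = x & exists c, p.[a] = 2 ^+ k.+1 * c.
  exists a => //; have e8 : 2 ^+ 3 = 8 :> R by ring.
  by rewrite pa e8 c8 mul0r.
elim: k => [|k [a ax [c pa]]].
  have [a ax] := surj x; exists a => //.
  by apply: ker; rewrite -horner_map ax px0.
have [v vE] := surj ((map_poly pi p)^`().[x])^-1.
have [d dE] : exists d, 1 - p^`().[a] * v = 2 * d.
  apply: ker; rewrite rmorphB rmorph1 rmorphM vE -horner_map ax -deriv_map.
  by rewrite mulfV ?subrr.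
have [e pah] := horner_taylor_order2 p a (- (2 ^+ k.+1 * c * v)).
exists (a - 2 ^+ k.+1 * c * v).
  rewrite rmorphB !rmorphM rmorphXn /= rmorph_nat residue_two exprS.
  by rewrite !mul0r subr0.
exists (c * d + e * 2 ^+ k * (c * v) ^+ 2).
rewrite pah pa [2 ^+ k.+2]exprS.
have -> : 2 ^+ k.+1 * c + p^`().[a] * - (2 ^+ k.+1 * c * v)
   = 2 ^+ k.+1 * c * (1 - p^`().[a] * v) by ring.
rewrite dE !exprS; ring.
Qed.

(** The discriminant argument: e is the reduction of (d - 1) / 2, where d is the
    product of the differences of the lifted roots, whose square is n or - n. *)
Lemma exists_primitive_cube_root n t (x : 'I_n -> K) :
    (0 < t)%N -> (6 * t < n)%N -> (n %% 8 = 3 \/ n %% 8 = 5)%N -> injective x ->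
    (forall i, (pentalift K n t).[x i] = 0) ->
  exists e : K, e ^+ 2 + e + 1 = 0.
Proof.
move=> t0 tn n8 x_inj gx.
have [surj ker tors c8] := piU.
have K2 := residue_two.
have N1 : -1 = 1 :> K by apply/eqP; rewrite eq_sym -addr_eq0 -mulr2n K2.
have n_odd : odd n by rewrite (divn_eq n 8) oddD oddM andbF; case: n8 => ->.
have nR (S : nzRingType) : 8 = 0 :> S -> n%:R = (n %% 8)%:R :> S.
  by move=> e; rewrite [in LHS](divn_eq n 8) natrD natrM e mulr0 add0r.
have nK : n%:R = 1 :> K.
  by rewrite -[n]odd_double_half n_odd natrD -mul2n natrM K2 mul0r addr0.
have n0 : (0 < n)%N by lia.
have /fin_all_exists2[a pia ga] i :
    exists2 a, pi a = x i & (pentalift R n t).[a] = 0.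
  (* Over K the derivative is X^(n-1), which does not vanish at a root. *)
  apply: hensel; rewrite map_pentalift // ; apply/eqP => d0.
  have := horner_deriv_pentalift (x i) t0 n0; rewrite d0 !natrM nK.
  have -> : 6 = 2 * 3 :> K by ring.
  rewrite K2 !mul0r mul1r mulr0 addr0 => /eqP; rewrite eq_sym mulf_eq0 expf_eq0.
  have := gx i; rewrite horner_pentalift => gxi.
  case/orP=> [z0|/andP[_ z0]]; move: gxi.
    rewrite (eqP z0) expr0n addr0 => /eqP; rewrite expf_eq0 => /andP[_ /eqP x0].
    by move: z0; rewrite x0 expr0n gtn_eqF // addr0 oner_eq0.
  rewrite (eqP z0) !expr0n (gtn_eqF t0) gtn_eqF; last by lia.
  by rewrite add0r addr0 expr1n => /eqP; rewrite oner_eq0.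
have [gM gsize] := monic_pentalift R tn.
have fact : pentalift R n t = \prod_i ('X - (a i)%:P).
  apply: prod_XsubC_of_roots => // i j ij; apply: lreg_of_residue.
  by rewrite rmorphB !pia subr_eq0 (inj_eq x_inj).
have [d [k dE]] := prod_diff_square a.
have {dE} d2 : d ^+ 2 = (-1) ^+ k * n%:R.
  rewrite -(prod_deriv_pentalift t0 tn n_odd c8 fact).
  under eq_bigr do rewrite fact horner_deriv_prod.
  by rewrite dE mulrA -exprD addnn -mul2n exprM sqrrN !expr1n mul1r.
have pd : pi d = 1.
  have pd2 : pi d ^+ 2 = 1.
    rewrite -rmorphXn d2 rmorphM rmorphXn rmorphN rmorph1 rmorph_nat.
    by rewrite N1 nK expr1n mulr1.
  have : (pi d - 1) ^+ 2 = 0.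
    have -> : (pi d - 1) ^+ 2 = pi d ^+ 2 - 1 - 2 * (pi d - 1) by ring.
    by rewrite pd2 subrr K2 mul0r subr0.
  by move/eqP; rewrite expf_eq0 subr_eq0 => /andP[_ /eqP].
have [e de] : exists e, d - 1 = 2 * e.
  by apply: ker; rewrite rmorphB rmorph1 pd subrr.
have {de} de : d = 1 + 2 * e by rewrite -de; ring.
exists (pi e).
have no3 y : 1 + 4 * y = 3 :> R -> False.
  move=> y3; have : pi (2 * y - 1) = 0.
    apply: tors; have -> : 4 * (2 * y - 1) = 2 * (1 + 4 * y - 3) by ring.
    by rewrite y3 subrr mulr0.
  rewrite rmorphB rmorphM rmorph_nat K2 mul0r sub0r rmorph1 N1.
  by move/eqP; rewrite oner_eq0.
have d2' : d ^+ 2 = 1 + 4 * (e ^+ 2 + e) by rewrite de; ring.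
have m3 : -3 = 5 :> R by apply/eqP; rewrite eq_sym -addr_eq0 -natrD c8.
have {}d2 : d ^+ 2 = 3 \/ d ^+ 2 = -3.
  rewrite d2 nR // -signr_odd.
  case: n8 => ->; case: (odd k); rewrite ?expr0 ?expr1 ?mulN1r ?mul1r.
  - by right.
  - by left.
  - by left; rewrite -m3 opprK.
  - by right.
case: d2 => d2; first by case: (no3 (e ^+ 2 + e)); rewrite -d2'.
suff : pi (e ^+ 2 + e + 1) = 0 by rewrite !rmorphD rmorphXn rmorph1.
apply: tors.
have -> : 4 * (e ^+ 2 + e + 1) = (1 + 4 * (e ^+ 2 + e)) + 3 by ring.
by rewrite -d2' d2 addNr.
Qed.
End Unramified.

(** * Conjugate roots in the field with 2^n elements *)

(** If e^2 + e + 1 = 0 then e^4 = e, so e is fixed by x -> x^(4^m). Since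
    2^n = 2 * 4^m for some m, the identity x^(2^n) = x then gives e^2 = e, which
    leaves 1 = 0. *)
Lemma no_cube_root (K : finFieldType) n (e : K) :
  #|K| = (2 ^ n)%N -> odd n -> 2 = 0 :> K -> e ^+ 2 + e + 1 != 0.
Proof.
move=> cK n_odd K2; apply/eqP => e0.
have e4 : e ^+ 4 = e.
  apply/eqP; rewrite -subr_eq0.
  have -> : e ^+ 4 - e = (e ^+ 2 - e) * (e ^+ 2 + e + 1) by ring.
  by rewrite e0 mulr0.
have e4m m : e ^+ (4 ^ m) = e.
  by elim: m => [|m IH]; rewrite ?expr1 // expnS exprM e4.
have ee : e ^+ 2 = e.
  rewrite -[RHS]expf_card cK -[n]odd_double_half n_odd expnD -mul2n expnM.
  by rewrite mulnC exprM e4m.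
move: e0; rewrite ee -mulr2n -mulr_natr K2 mulr0 add0r => /eqP.
by rewrite oner_eq0.
Qed.

Lemma F2P (c : 'F_2) : c = 0 \/ c = 1.
Proof. by case: c => [[|[|m]] ltm]; [left|right|]; try exact: val_inj. Qed.

Section Frobenius.
Variables (K : finFieldType) (n : nat) (ev : {rmorphism {poly 'F_2} -> K}).
Hypothesis ev_surj : forall y, exists p, ev p = y.
Hypothesis cardK : #|K| = (2 ^ n)%N.

Lemma ev_two : 2 = 0 :> K.
Proof.
rewrite -[2](rmorph_nat ev 2) (_ : 2 = 0) ?rmorph0 // -polyC_natr.
by rewrite (_ : 2 = 0 :> 'F_2) //; apply: val_inj.
Qed.

Lemma frobD d (a b : K) : (a + b) ^+ (2 ^ d) = a ^+ (2 ^ d) + b ^+ (2 ^ d).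
Proof.
apply: exprDn_pchar; rewrite pnatX; apply/orP; left; rewrite pnatE //.
by rewrite inE /= ev_two eqxx.
Qed.

Lemma frob_inj d : injective (fun a : K => a ^+ (2 ^ d)).
Proof.
move=> a b /= ab; have : (a - b) ^+ (2 ^ d) + b ^+ (2 ^ d) = b ^+ (2 ^ d).
  by rewrite -frobD subrK.
move/(canRL (addrK _)); rewrite subrr => /eqP.
by rewrite expf_eq0 subr_eq0 => /andP[_ /eqP].
Qed.

Lemma frob_fixed d : ev 'X ^+ (2 ^ d) = ev 'X -> forall y : K, y ^+ (2 ^ d) = y.
Proof.
move=> fX y; have [p <-] := ev_surj y.
elim/poly_ind: p => [|p c IH]; first by rewrite rmorph0 expr0n expn_eq0.
rewrite rmorphD rmorphM frobD exprMn IH fX; congr (_ + _).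
case: (F2P c) => ->; rewrite ?rmorph0 ?rmorph1 ?expr1n //.
by rewrite expr0n expn_eq0.
Qed.

(** A coincidence between two conjugates of ev 'X would make a power
    x -> x^(2^d) of the Frobenius map, with 0 < d < n, the identity on K, which
    is generated by ev 'X. But X^(2^d) - X has at most 2^d < #|K| roots. *)
Lemma frob_orbit_inj : injective (fun i : 'I_n => ev 'X ^+ (2 ^ i)).
Proof.
suff lt_neq (i j : 'I_n) : (i < j)%N -> ev 'X ^+ (2 ^ i) <> ev 'X ^+ (2 ^ j).
  move=> i j /= ij; apply: val_inj.
  case: (ltngtP i j) => // /lt_neq; first by move/(_ ij).
  by move/(_ (esym ij)).
move=> ij eqX.
have fixK : forall y : K, y ^+ (2 ^ (j - i)) = y.
  apply: frob_fixed; apply: (@frob_inj i).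
  by rewrite -exprM -expnD subnK ?eqX // ltnW.
pose p : {poly K} := 'X^(2 ^ (j - i)) - 'X.
have d_gt1 : (1 < 2 ^ (j - i))%N by rewrite -{1}(expn0 2) ltn_exp2l // subn_gt0.
have sp : size p = (2 ^ (j - i)).+1.
  by rewrite size_polyDl size_polyXn // size_polyN size_polyX.
have p0 : p != 0 by rewrite -size_poly_gt0 sp.
have rp : all (root p) (enum K).
  by apply/allP => y _; rewrite /root !hornerE fixK subrr.
have := max_poly_roots p0 rp (enum_uniq _).
rewrite sp -cardE cardK ltnS leq_exp2l //.
by rewrite leqNgt => /negP; apply; have := ltn_ord j; lia.
Qed.

Lemma frob_orbit_roots m t i : ev (pentalift _ m t) = 0 ->
  (pentalift K m t).[ev 'X ^+ (2 ^ i)] = 0.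
Proof.
move=> evg; rewrite horner_pentalift.
have {}evg : ev 'X ^+ m + (1 + ev 'X ^+ t) ^+ 6 = 0.
  by rewrite -[RHS]evg /pentalift !(rmorphD, rmorphXn, rmorph1).
have -> : 1 + (ev 'X ^+ (2 ^ i)) ^+ t = (1 + ev 'X ^+ t) ^+ (2 ^ i).
  by rewrite frobD expr1n exprAC.
by rewrite exprAC [X in _ + X]exprAC -frobD evg expr0n expn_eq0.
Qed.
End Frobenius.

(** * The unramified extension of Z/8 defined by a polynomial *)

Definition red8 (c : 'Z_8) : 'F_2 := (c : nat)%:R.

Lemma F2_nat_mod8 m : (m %% 8)%:R = m%:R :> 'F_2.
Proof.
rewrite [in RHS](divn_eq m 8) natrD natrM (_ : 8 = 0 :> 'F_2) ?mulr0 ?add0r //.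
exact: val_inj.
Qed.

Lemma red8_zmod : zmod_morphism red8.
Proof.
move=> c d; apply/eqP; rewrite eq_sym subr_eq; apply/eqP.
by rewrite -natrD -[RHS]F2_nat_mod8 -[X in red8 X](subrK d c).
Qed.

Lemma red8_monoid : monoid_morphism red8.
Proof.
by split=> [|c d]; rewrite /red8 ?F2_nat_mod8 // -natrM -F2_nat_mod8.
Qed.

HB.instance Definition _ := GRing.isZmodMorphism.Build _ _ red8 red8_zmod.
HB.instance Definition _ := GRing.isMonoidMorphism.Build _ _ red8 red8_monoid.

Section GaloisRing.
(* K plays the part of F_2[X]/(g), for g the reduction of G, and ev that of the
   class map; the hypotheses say that g generates the kernel of ev. *)
Variables (n : nat) (G : {poly 'Z_8}).
Variables (K : fieldType) (ev : {rmorphism {poly 'F_2} -> K}).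
Hypothesis n_gt0 : (0 < n)%N.
Hypothesis G_monic : G \is monic.
Hypothesis size_G : size G = n.+1.
Hypothesis ev_surj : forall y, exists p, ev p = y.
Hypothesis evG : ev (map_poly red8 G) = 0.
Hypothesis ev_inj :
  forall p : {poly 'F_2}, (size p <= n)%N -> ev p = 0 -> p = 0.

Let mkG : mk_monic G = G.
Proof. by rewrite /mk_monic size_G ltnS n_gt0 G_monic. Qed.

Definition residue (a : {poly %/ G}) : K := ev (map_poly red8 (val a)).

Lemma residue_in_qpoly p : residue (in_qpoly G p) = ev (map_poly red8 p).
Proof.
rewrite /residue /= mkG [in RHS](Pdiv.RingMonic.rdivp_eq G_monic p).
by rewrite !rmorphD !rmorphM evG mulr0 add0r.
Qed.

Lemma in_qpolyK (a : {poly %/ G}) : in_qpoly G (val a) = a.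
Proof. by apply/val_inj/in_qpoly_small/size_mk_monic. Qed.

Lemma residue_zmod : zmod_morphism residue.
Proof. by move=> a b; rewrite /residue !raddfB. Qed.

Lemma residue_monoid : monoid_morphism residue.
Proof.
split=> [|a b]; first by rewrite -(in_qpoly1 G) residue_in_qpoly !rmorph1.
rewrite -[a in LHS]in_qpolyK -[b in LHS]in_qpolyK -in_qpolyM residue_in_qpoly.
by rewrite !rmorphM.
Qed.

HB.instance Definition _ := GRing.isZmodMorphism.Build _ _ residue residue_zmod.
HB.instance Definition _ :=
  GRing.isMonoidMorphism.Build _ _ residue residue_monoid.

Lemma residue_unramified : unramified_mod8 residue.
Proof.
have Z8P (c : 'Z_8) :
    (red8 c = 0 -> c = 2 * inZp (c./2)) /\ (c *+ 4 = 0 -> red8 c = 0).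
  by case: c => [[|[|[|[|[|[|[|[|m]]]]]]]] ltm]; split=> // _; apply: val_inj.
split=> [y|a|a|].
- have [p <-] := ev_surj y.
  exists (in_qpoly G (map_poly (fun c : 'F_2 => inZp c : 'Z_8) p)).
  rewrite [LHS]residue_in_qpoly; congr (ev _); apply/polyP=> i.
  rewrite coef_map coef_map_id0 //; last exact: val_inj.
  by case: (F2P p`_i) => ->; apply: val_inj.
- move=> ra; have m0 : map_poly red8 (val a) = 0.
    apply: ev_inj ra; apply: leq_trans (size_poly _ _) _.
    by rewrite -ltnS -size_G -[in X in (_ < X)%N]mkG size_mk_monic.
  exists (in_qpoly G (map_poly (fun c : 'Z_8 => inZp (c./2) : 'Z_8) (val a))).
  rewrite -[LHS]in_qpolyK -(rmorph_nat (in_qpoly G) 2) -in_qpolyM.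
  congr (in_qpoly _ _); apply/polyP=> i.
  rewrite -polyC_natr coefCM coef_map_id0 //; last exact: val_inj.
  by apply: (Z8P _).1; rewrite -coef_map m0 coef0.
- move=> a4; rewrite -[a]in_qpolyK [LHS]residue_in_qpoly.
  rewrite (_ : map_poly _ _ = 0) ?rmorph0 //.
  apply/polyP=> i; rewrite coef_map coef0; apply: (Z8P _).2.
  by rewrite -coefMn -raddfMn -mulr_natl a4 coef0.
rewrite -(rmorph_nat (in_qpoly G)) -polyC_natr (_ : 8 = 0 :> 'Z_8) ?rmorph0 //.
exact: val_inj.
Qed.
End GaloisRing.

Lemma pentalift_not_irreducible (n t : nat) : (0 < t)%N -> (6 * t < n)%N ->
    (n %% 8 = 3 \/ n %% 8 = 5)%N -> ~ irreducible_poly (pentalift 'F_2 n t).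
Proof.
move=> t0 tn n8 g_irr.
have [gM sg] := monic_pentalift 'F_2 tn.
have [GM sG] := monic_pentalift 'Z_8 tn.
have n0 : (0 < n)%N by lia.
have n_odd : odd n by rewrite (divn_eq n 8) oddD oddM andbF; case: n8 => ->.
pose g := pentalift 'F_2 n t.
have gI : monic_irreducible_poly g by split.
pose K : finFieldType := {poly %/ g with gI}.
pose ev : {rmorphism {poly 'F_2} -> K} := in_qpoly g.
have cardK : #|K| = (2 ^ n)%N by rewrite card_qfpoly sg card_Fp.
have mkg : mk_monic g = g by rewrite /mk_monic sg ltnS n0 gM.
have ev_surj y : exists p, ev p = y.
  exists (val (y : {poly %/ g})); apply/val_inj/in_qpoly_small/size_mk_monic.
have ev_inj (p : {poly 'F_2}) : (size p <= n)%N -> ev p = 0 -> p = 0.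
  move=> sp /(congr1 (fun a : {poly %/ g} => val a)) /=.
  by rewrite mkg Pdiv.CommonRing.rmodp_small ?sg ?ltnS.
have evg : ev g = 0 by apply: val_inj; rewrite /= mkg Pdiv.RingMonic.rmodpp.
have evG : ev (map_poly red8 (pentalift _ n t)) = 0 by rewrite map_pentalift.
have U := residue_unramified n0 GM sG ev_surj evG ev_inj.
have K2 := residue_two U.
have [e e0] := exists_primitive_cube_root U t0 tn n8
  (frob_orbit_inj ev_surj cardK) (fun i => frob_orbit_roots i evg).
by have := no_cube_root e cardK n_odd K2; rewrite e0 eqxx.
Qed.

(** * Reducibility and reciprocal polynomials *)

Lemma reducible_of_not_irreducible (F : finFieldType) (p : {poly F}) :
  (1 < size p)%N -> ~ irreducible_poly p -> reducible_poly p.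
Proof.
move=> sp /irreducibleP; rewrite /irreducibleb sp /= negb_forall.
case/existsP=> [[q /= sq]]; rewrite negb_imply -ltnNge => /andP[qp q_gt1].
move: qp; rewrite -dvdpE => /dvdpP[r pE].
exists r, q; split=> //.
have p0 : p != 0 by rewrite -size_poly_gt0 ltnW.
have /andP[r0 q0] : (r != 0) && (q != 0) by rewrite -negb_or -mulf_eq0 -pE.
have : (size q <= (size p).-1)%N := sq.
rewrite pE size_mul //; have : (0 < size r)%N by rewrite size_poly_gt0.
move: q_gt1; move: (size q) (size r) => a b; lia.
Qed.

Section Reciprocal.
Variable F : idomainType.
(** X^m p(1/X). The nominal degree m is a parameter, which makes the map linear,
    so that multiplicativity can be checked on monomials. *)
Definition recip (m : nat) (p : {poly F}) : {poly F} :=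
  \poly_(i < m.+1) p`_(m - i).

Lemma recip_is_linear m : linear (recip m).
Proof.
move=> c p q; apply/polyP=> i; rewrite !(coefD, coefZ, coef_poly).
by case: ltnP => _; rewrite ?mulr0 ?addr0 // coefD coefZ.
Qed.
HB.instance Definition _ m :=
  GRing.isLinear.Build F {poly F} {poly F} _ (recip m) (recip_is_linear m).

Lemma recipXn m k : (k <= m)%N -> recip m 'X^k = 'X^(m - k).
Proof.
move=> km; apply/polyP=> i; rewrite coef_poly !coefXn.
case: ltnP => im; last by rewrite (_ : (i == m - k)%N = false) //; lia.
by rewrite (_ : (m - i == k)%N = (i == m - k)%N) //; lia.
Qed.

Lemma recipM m k (p q : {poly F}) : (size p <= m.+1)%N -> (size q <= k.+1)%N ->
  recip (m + k) (p * q) = recip m p * recip k q.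
Proof.
move=> sp sq.
have expand d (r : {poly F}) :
    (size r <= d.+1)%N -> r = \sum_(i < d.+1) r`_i *: 'X^i.
  move=> sr; rewrite -poly_def; apply/polyP=> i; rewrite coef_poly.
  by case: ltnP => // di; rewrite nth_default // (leq_trans sr).
rewrite (expand m p sp) (expand k q sq) mulr_suml !linear_sum mulr_suml.
apply: eq_bigr => i _; rewrite mulr_sumr linear_sum mulr_sumr.
apply: eq_bigr => j _.
have [im jk] := (ltn_ord i, ltn_ord j); rewrite ltnS in im; rewrite ltnS in jk.
rewrite -scalerAl -scalerAr !linearZ /= -exprD !recipXn ?leq_add //.
by rewrite -scalerAl -scalerAr -exprD; congr (_ *: (_ *: 'X^_)); lia.
Qed.

Lemma size_recip m (p : {poly F}) : p`_0 != 0 -> size (recip m p) = m.+1.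
Proof. by move=> p0; apply: size_poly_eq; rewrite subnn. Qed.

(** A factor of p has nonzero constant coefficient, so that its reciprocal has
    the same degree. *)
Lemma reducible_recip n (p : {poly F}) : size p = n.+1 -> p`_0 != 0 ->
  reducible_poly p -> reducible_poly (recip n p).
Proof.
move=> sp p0 [q [r [sq sr pE]]].
move: (p0); rewrite pE coef0M mulf_eq0 negb_or => /andP[q0 r0].
exists (recip (size q).-1 q), (recip (size r).-1 r).
have [q_gt0 r_gt0] := (ltnW sq, ltnW sr).
rewrite !size_recip // !prednK //; split=> //.
rewrite -recipM ?prednK // -pE; congr (recip _ _).
have : size p = (size q + size r).-1 by rewrite pE size_mul // -size_poly_gt0.
by rewrite sp; lia.
Qed.
End Reciprocal.

Lemma polyF2_two : 2 = 0 :> {poly 'F_2}.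
Proof.
by rewrite -polyC_natr (_ : 2 = 0 :> 'F_2) ?polyC0 //; apply: val_inj.
Qed.

Lemma pentag_pentalift n t : pentag n (2 * t) = pentalift _ n t.
Proof.
rewrite /pentag /pentalift.
have Xe k : 'X^(k * (2 * t)) = ('X^t) ^+ (2 * k) :> {poly 'F_2}.
  by rewrite -exprM; congr ('X^_); lia.
rewrite !Xe; have := Xe 1%N; rewrite !mul1n => ->; move: 'X^n 'X^t => Y Z.
apply/eqP; rewrite -subr_eq0; apply/eqP.
(* The coefficients 1, 6, 15, 20, 15, 6, 1 of (1 + Z)^6 are compared with the
   coefficients 1, 0, 1, 0, 1, 0, 1 of g. *)
pose h := 3 * Z + 7 * Z ^+ 2 + 10 * Z ^+ 3 + 7 * Z ^+ 4 + 3 * Z ^+ 5.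
rewrite [LHS](_ : _ = - 2 * h); last by rewrite /h; ring.
by rewrite polyF2_two oppr0 mul0r.
Qed.

Lemma recip_pentag n s : (3 * s <= n)%N -> recip n (pentag n s) = pentaf n s.
Proof.
move=> sn; rewrite /pentag /pentaf -[1](expr0 'X) !raddfD /= !recipXn //;
  try lia.
rewrite subnn subn0 expr0; ring.
Qed.

Lemma pentag_reducible (s n : nat) : (0 < s)%N -> ~~ odd s -> (3 * s < n)%N ->
    n <> 1 %[mod 8] /\ n <> 7 %[mod 8] ->
  reducible_poly (pentag n s).
Proof.
move=> s_gt0 s_even n_gt3s n_mod8.
have [t sE] : exists t, s = (2 * t)%N by exists s./2; lia.
have t0 : (0 < t)%N by lia.
have tn : (6 * t < n)%N by lia.
rewrite sE pentag_pentalift.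
have [gM sg] := monic_pentalift 'F_2 tn.
have [n_odd|n_even] := boolP (odd n).
  apply: reducible_of_not_irreducible; first by rewrite sg; lia.
  by apply: pentalift_not_irreducible => //; lia.
have [m nE] : exists m, n = (2 * m)%N by exists n./2; lia.
pose q : {poly 'F_2} := 'X^m + (1 + 'X^t) ^+ 3.
have gq : pentalift 'F_2 n t = q * q.
  rewrite /pentalift nE mulnC exprM /q; move: 'X^m (1 + _) => Y Z.
  have -> : (Y + Z ^+ 3) * (Y + Z ^+ 3) = Y ^+ 2 + Z ^+ 6 + 2 * (Y * Z ^+ 3).
    by ring.
  by rewrite polyF2_two mul0r addr0.
suff sq : (1 < size q)%N by exists q, q.
have q0 : q != 0.
  apply: contraTneq gM => q0.
  by rewrite gq q0 mul0r monicE lead_coef0 eq_sym oner_eq0.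
by have := size_mul q0 q0; rewrite -gq sg; move: (size q) => k; lia.
Qed.

Local Close Scope ring_scope.

Theorem theorem1p1 (s n : nat) (s_gt0 : 0 < s) (s_even : ~~ odd s)
    (n_gt3s : 3 * s < n)
    (n_mod8 : n <> 1 %[mod 8] /\ n <> 7 %[mod 8]) :
  reducible_poly (pentaf n s) /\ reducible_poly (pentag n s).
Proof.
have g_red := pentag_reducible s_gt0 s_even n_gt3s n_mod8; split=> //.
rewrite -recip_pentag 1?ltnW //.
have [t sE] : exists t, s = 2 * t by exists s./2; lia.
have t_gt0 : 0 < t by lia.
have tn : 6 * t < n by lia.
have gE : pentag n s = pentalift _ n t by rewrite sE pentag_pentalift.
apply: reducible_recip => //.
  by rewrite gE; case: (monic_pentalift 'F_2 tn).
by rewrite -horner_coef0 gE horner_pentalift !expr0n !gtn_eqF //; lia.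
Qed.
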